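(* Let $A$ be a $3\times3$ integer matrix and let $q(\mathbf{x})=J(A\mathbf{x})$, where $J(\mathbf{x})=x_1x_3-x_2^2$. Then there is a matrix $U\in\mathrm{Aut}(J)$ such that the rows $\mathbf{a},\mathbf{b},\mathbf{c}$ of $UA$ satisfy $\|\mathbf{a}\|\cdot\|\mathbf{c}\|\le 9\|q\|$ and $\|\mathbf{b}\|^2\le 10\|q\|$.
   Context: $\mathrm{Aut}(J)$ is the set of $3\times3$ integer matrices $U$ with $J(U\mathbf{x})=J(\mathbf{x})$ identically. For a ternary quadratic form $q(\mathbf{x})=\sum_{1\le i\le j\le3}q_{ij}x_ix_j$, $\|q\|$ is the Frobenius norm of $Q=\begin{pmatrix}2q_{11}&q_{12}&q_{13}\\ q_{12}&2q_{22}&q_{23}\\ q_{13}&q_{23}&2q_{33}\end{pmatrix}$. $\|\cdot\|$ on vectors is the Euclidean norm. *)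

(* Defs.v *)
From mathcomp Require Import all_boot all_order all_algebra.
From mathcomp Require Import reals.

Set Implicit Arguments.
Unset Strict Implicit.
Unset Printing Implicit Defensive.

Import GRing.Theory.
Local Open Scope ring_scope.

Definition J (x : 'cV[int]_3) : int := x 0 0 * x 2 0 - x 1 0 ^+ 2.

(* An identity between integral forms may be tested on integral vectors,
   since Z is an infinite domain. *)
Definition AutJ (U : 'M[int]_3) : Prop :=
  forall x : 'cV[int]_3, J (U *m x) = J x.

(* The form sum_(i <= j) q_ij x_i x_j is given by its coefficients q i j, i <= j;
   the values q i j for j < i are never used. *)
Definition qform := 'I_3 -> 'I_3 -> int.

Definition qform_eval (q : qform) (x : 'cV[int]_3) : int :=
  \sum_(i < 3) \sum_(j < 3 | (i <= j)%N) q i j * x i 0 * x j 0.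

Definition qform_mx (q : qform) : 'M[int]_3 :=
  \matrix_(i, j) if i == j then 2 * q i i
                 else if (i < j)%N then q i j else q j i.

Definition frobenius_norm (R : realType) (m n : nat) (M : 'M[int]_(m, n)) : R :=
  Num.sqrt (\sum_(i < m) \sum_(j < n) (M i j)%:~R ^+ 2).

Definition vec_norm (R : realType) (n : nat) (v : 'rV[int]_n) : R :=
  Num.sqrt (\sum_(j < n) (v 0 j)%:~R ^+ 2).

Definition qform_norm (R : realType) (q : qform) : R :=
  frobenius_norm R (qform_mx q).

(* Main.v *)
(** Write [a], [b], [c] for the rows of [A]. The group [Aut(J)] contains the
swap of [a] and [c] and the translations [b -> b + k a],
[c -> c + 2 k b + k^2 a]. Translating to get [2 |a.b| <= |a|^2] and swapping
whenever [|c| < |a|], which lowers [|a|], one reaches [2 |a.b| <= |a|^2 <= |c|^2].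
Such rows satisfy the bounds: splitting [b] and [c] along [a] and its orthogonal
complement makes [||Q||^2] a sum of squares, which controls the orthogonal part
of [b] and shows that [|a|^2] and [|a| |c|] are [O(||Q||)]. *)

Require Import Defs.
From mathcomp Require Import all_boot all_order all_algebra.
From mathcomp Require Import reals.
From mathcomp Require Import zify ring lra.

Set Implicit Arguments.
Unset Strict Implicit.
Unset Printing Implicit Defensive.

Import GRing.Theory.
Import Order.TTheory Num.Theory.
Local Open Scope ring_scope.

Lemma sum_ord3 (V : nmodType) (F : 'I_3 -> V) :
  \sum_i F i = F 0 + F 1 + F 2.
Proof.
rewrite !big_ord_recl big_ord0 addr0 addrA.
by congr (F _ + F _ + F _); apply: val_inj.
Qed.

Definition dotv (F : pzRingType) (n : nat) (u v : 'rV[F]_n) : F :=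
  \sum_j u 0 j * v 0 j.

Lemma dotvC (F : comPzRingType) n (u v : 'rV[F]_n) : dotv u v = dotv v u.
Proof. by apply: eq_bigr => j _; rewrite mulrC. Qed.

Lemma dotvDr (F : pzRingType) n (u v w : 'rV[F]_n) :
  dotv u (v + w) = dotv u v + dotv u w.
Proof. by rewrite -big_split; apply: eq_bigr => j _; rewrite mxE mulrDr. Qed.

Lemma dotvZr (F : comPzRingType) n k (u v : 'rV[F]_n) :
  dotv u (k *: v) = k * dotv u v.
Proof. by rewrite big_distrr; apply: eq_bigr => j _; rewrite mxE mulrCA. Qed.

Lemma dotv_ge0 (F : realDomainType) n (u : 'rV[F]_n) : 0 <= dotv u u.
Proof. by apply: sumr_ge0 => j _; rewrite -expr2 sqr_ge0. Qed.

Lemma dotv_eq0 (F : realDomainType) n (u : 'rV[F]_n) :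
  dotv u u = 0 -> u = 0.
Proof.
move/eqP; rewrite psumr_eq0 => [/allP u0|j _]; last by rewrite -expr2 sqr_ge0.
apply/rowP => j; rewrite mxE; apply/eqP; rewrite -sqrf_eq0 expr2.
by apply: u0; rewrite mem_index_enum.
Qed.

(** This is the squared length of [x a + y b + z c], expanded so that a choice of coefficients
    yields an inequality between dot products. *)
Lemma gram3_ge0 (F : realDomainType) n (a b c : 'rV[F]_n) (x y z : F) :
  0 <= x ^+ 2 * dotv a a + y ^+ 2 * dotv b b + z ^+ 2 * dotv c c
     + 2 * x * y * dotv a b + 2 * x * z * dotv a c + 2 * y * z * dotv b c.
Proof.
suff -> : x ^+ 2 * dotv a a + y ^+ 2 * dotv b b + z ^+ 2 * dotv c c
     + 2 * x * y * dotv a b + 2 * x * z * dotv a c + 2 * y * z * dotv b c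
   = dotv (x *: a + y *: b + z *: c) (x *: a + y *: b + z *: c).
  exact: dotv_ge0.
rewrite !dotvDr !dotvZr ![dotv (_ + _) _]dotvC !dotvDr !dotvZr.
by rewrite (dotvC b a) (dotvC c a) (dotvC c b); ring.
Qed.

(* The squared Frobenius norm of [a^T c + c^T a - 2 b^T b]. *)
Definition gram_norm2 (F : pzRingType) n (a b c : 'rV[F]_n) : F :=
  2 * dotv a c ^+ 2 + 2 * dotv a a * dotv c c
  - 8 * dotv a b * dotv b c + 4 * dotv b b ^+ 2.

(** The constants are [9 ^+ 2] and [10 ^+ 2]: the bounds are squared to avoid roots. *)
Lemma reduced_bounds (F : realFieldType) n (a b c : 'rV[F]_n) :
    2 * `|dotv a b| <= dotv a a -> dotv a a <= dotv c c ->
  dotv a a * dotv c c <= 81 * gram_norm2 a b c /\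
  dotv b b ^+ 2 <= 100 * gram_norm2 a b c.
Proof.
move=> hab hac; rewrite /gram_norm2.
have [a0|a_neq0] := eqVneq (dotv a a) 0.
  have dot0 v : dotv a v = 0.
    by rewrite (dotv_eq0 a0); apply: big1 => j _; rewrite mxE mul0r.
  by rewrite !dot0; have := sqr_ge0 (dotv b b); split; nra.
have gram := gram3_ge0 a b c.
have p_gt0 : 0 < dotv a a by rewrite lt_def a_neq0 dotv_ge0.
move: hab hac a_neq0 gram p_gt0.
set p := dotv a a; set r := dotv a b; set s := dotv a c.
set t := dotv b b; set w := dotv b c; set v := dotv c c.
move=> hr hv p_neq0 gram p_gt0.
(* The squared length of the projection of [b] on [a]; hence [t - e] is that of the orthogonal part
   of [b]. *)
pose e := r ^+ 2 / p.
have re : r ^+ 2 = e * p by rewrite /e; field.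
have e_ge0 : 0 <= e by rewrite /e divr_ge0 ?sqr_ge0 ?ltW.
have e_le : 4 * e <= p.
  have : 4 * r ^+ 2 <= p ^+ 2.
    have := normr_ge0 r; rewrite -(real_normK (num_real r)); nra.
  by rewrite re expr2 mulrA ler_pM2r.
(* The combination [r a - p b] is [-p] times the orthogonal part of [b]. *)
have Z_ge0 : 0 <= t - e.
  have := gram r (- p) 0.
  have -> : r ^+ 2 * p + (- p) ^+ 2 * t + 0 ^+ 2 * v + 2 * r * - p * r
    + 2 * r * 0 * s + 2 * - p * 0 * w = p ^+ 2 * (t - e).
    by transitivity (p ^+ 2 * t - p * r ^+ 2); [ring | rewrite re; ring].
  by rewrite pmulr_rge0 // exprn_gt0.
(* This is [|p c' - 4 r b'|^2 >= 0] for the parts [b'], [c'] orthogonal to [a]. *)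
have D_ge0 : 0 <= p * v - s ^+ 2 - 8 * (r * w - e * s) + 16 * e * (t - e).
  have := gram (4 * e - s) (- 4 * r) p.
  set lhs := (X in 0 <= X -> _).
  have -> : lhs = p * (p * v - s ^+ 2 - 8 * (r * w - e * s) + 16 * e * (t - e)).
    transitivity ((4 * e - s) ^+ 2 * p + 16 * r ^+ 2 * t + p ^+ 2 * v
      - 8 * (4 * e - s) * r ^+ 2 + 2 * (4 * e - s) * p * s - 8 * r * p * w).
      by rewrite /lhs; ring.
    by rewrite re; ring.
  by rewrite pmulr_rge0.
have pv : p ^+ 2 <= p * v by rewrite expr2 ler_pM2l.
have eZ : 4 * (e * (t - e)) <= p * (t - e) by rewrite mulrA ler_wpM2r.
have ee : 16 * e ^+ 2 <= p ^+ 2 by nra.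
set N := (X in 81 * X).
(* The difference of the two sides is exactly the quantity in [D_ge0]. *)
have N_ge : 4 * (s - e) ^+ 2 + p * v - s ^+ 2 - 8 * (e * (t - e))
    + 4 * (t - e) ^+ 2 <= N.
  rewrite /N; lra.
have s_le : s ^+ 2 <= 2 * (s - e) ^+ 2 + 2 * e ^+ 2.
  have := sqr_ge0 (s - 2 * e); lra.
have t_le : t ^+ 2 <= 2 * (t - e) ^+ 2 + 2 * e ^+ 2.
  have := sqr_ge0 (t - 2 * e); lra.
have pZ : 4 * (p * (t - e)) <= p ^+ 2 + 4 * (t - e) ^+ 2.
  have := sqr_ge0 (p - 2 * (t - e)); lra.
(* The estimates combine to [N >= 2 (t - e)^2 + (3/8) p v], where [p v >= p^2 >= 16 e^2]; both
   bounds follow with room to spare. *)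
have := sqr_ge0 p; have := sqr_ge0 (s - e); have := sqr_ge0 (t - e).
by split; lra.
Qed.

Definition swapJ : 'M[int]_3 := \matrix_(i, j) (i + j == 2 :> nat)%:R.

(** [J] is the determinant of the symmetric matrix with rows [(x1, x2)] and [(x2, x3)]. This is the
    action on it of congruence by the matrix with rows [(1, 0)] and [(k, 1)]. *)
Definition shiftJ (k : int) : 'M[int]_3 :=
  \matrix_(i, j) ((i == j)%:R + (i == 1)%:R * (j == 0)%:R * k
    + (i == 2)%:R * (j == 1)%:R * (2 * k) + (i == 2)%:R * (j == 0)%:R * k ^+ 2).

Lemma row0_swapJ (A : 'M[int]_3) : row 0 (swapJ *m A) = row 2 A.
Proof. by apply/rowP => j; rewrite !mxE sum_ord3 !mxE /=; ring. Qed.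

Lemma row0_shiftJ k (A : 'M[int]_3) : row 0 (shiftJ k *m A) = row 0 A.
Proof. by apply/rowP => j; rewrite !mxE sum_ord3 !mxE /=; ring. Qed.

Lemma row1_shiftJ k (A : 'M[int]_3) :
  row 1 (shiftJ k *m A) = row 1 A + k *: row 0 A.
Proof. by apply/rowP => j; rewrite !mxE sum_ord3 !mxE /=; ring. Qed.

Lemma AutJ_swapJ : AutJ swapJ.
Proof. by move=> x; rewrite /J !mxE !sum_ord3 !mxE /=; ring. Qed.

Lemma AutJ_shiftJ k : AutJ (shiftJ k).
Proof. by move=> x; rewrite /J !mxE !sum_ord3 !mxE /=; ring. Qed.

Lemma AutJ_mul U V : AutJ U -> AutJ V -> AutJ (U *m V).
Proof. by move=> hU hV x; rewrite -mulmxA hU hV. Qed.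

Lemma centered_residue (p r : int) :
  0 <= p -> (p = 0 -> r = 0) -> exists k, 2 * `|r + k * p| <= p.
Proof.
rewrite le_eqVlt => /predU1P[<- /(_ erefl) -> | p_gt0 _]; first by exists 0.
(* The quotient is the floor of [r / p + 1/2], an integer nearest to [r / p]. *)
exists (- ((2 * r + p) %/ (2 * p))%Z).
have p2_gt0 : 0 < 2 * p by lia.
have := divz_eq (2 * r + p) (2 * p).
have := ltz_pmod (2 * r + p) p2_gt0.
have : 0 <= ((2 * r + p) %% (2 * p))%Z by rewrite modz_ge0 ?gt_eqF.
move: (_ %% _)%Z (_ %/ _)%Z => m k m_ge0 m_lt def.
suff : 2 * (r + - k * p) = m - p by lia.
rewrite mulrDr -(addrK p (2 * r)) def; ring.
Qed.

Lemma AutJ_reduction (A : 'M[int]_3) :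
  exists U, [/\ AutJ U,
    2 * `|dotv (row 0 (U *m A)) (row 1 (U *m A))|
      <= dotv (row 0 (U *m A)) (row 0 (U *m A))
  & dotv (row 0 (U *m A)) (row 0 (U *m A))
      <= dotv (row 2 (U *m A)) (row 2 (U *m A))].
Proof.
(* Descent on the squared length of the first row, a natural number. *)
have [m] := ubnP (absz (dotv (row 0 A) (row 0 A))).
elim: m A => // m IH A ltAm.
have [|k hk] := @centered_residue (dotv (row 0 A) (row 0 A))
  (dotv (row 0 A) (row 1 A)) (dotv_ge0 _).
  by move=> /dotv_eq0->; apply: big1 => j _; rewrite mxE mul0r.
(* The shift fixes the first row but changes the third, so the comparison uses the shifted third
   row. If that one is shorter, the swap makes it the first row and the measure drops. *)
have [le02|lt20] := leP (dotv (row 0 A) (row 0 A))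
  (dotv (row 2 (shiftJ k *m A)) (row 2 (shiftJ k *m A))).
  exists (shiftJ k); split; first exact: AutJ_shiftJ.
  - by rewrite row0_shiftJ row1_shiftJ dotvDr dotvZr.
  - by rewrite row0_shiftJ.
have [|U [hU U1 U2]] := IH (swapJ *m (shiftJ k *m A)).
  rewrite row0_swapJ -ltz_nat gez0_abs ?dotv_ge0 // (lt_le_trans lt20) //.
  by rewrite -(gez0_abs (dotv_ge0 _)) lez_nat -ltnS.
exists (U *m (swapJ *m shiftJ k)); rewrite -!mulmxA; split=> //.
by apply: AutJ_mul => //; apply: AutJ_mul; [exact: AutJ_swapJ | exact: AutJ_shiftJ].
Qed.

Lemma qform_evalE (q : qform) x :
  qform_eval q x = q 0 0 * x 0 0 ^+ 2 + q 1 1 * x 1 0 ^+ 2 + q 2 2 * x 2 0 ^+ 2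
    + q 0 1 * x 0 0 * x 1 0 + q 0 2 * x 0 0 * x 2 0 + q 1 2 * x 1 0 * x 2 0.
Proof.
rewrite /qform_eval sum_ord3.
rewrite 3!(big_mkcond (fun j : 'I_3 => (_ <= j)%N)) !sum_ord3 /=; ring.
Qed.

Lemma qform_mxE (q : qform) (A : 'M[int]_3) :
    (forall x, qform_eval q x = J (A *m x)) ->
  forall i j, qform_mx q i j =
    A 0 i * A 2 j + A 0 j * A 2 i - 2 * A 1 i * A 1 j.
Proof.
move=> hq.
(* The values at the basis vectors and at their pairwise sums determine the six coefficients. *)
have ev x0 x1 x2 := hq (\col_i [:: x0; x1; x2]`_i).
have := (ev 1 0 0, ev 0 1 0, ev 0 0 1, ev 1 1 0, ev 1 0 1, ev 0 1 1).
rewrite !qform_evalE /J !mxE !sum_ord3 !mxE /= => -[[[[[e0 e1] e2] e01] e02] e12].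
move=> i j.
have ord3 (l : 'I_3) : [\/ l = 0, l = 1 | l = 2].
  case: l => [[|[|[|//]]] hl]; [constructor 1|constructor 2|constructor 3];
  exact: val_inj.
by case: (ord3 i) => ->; case: (ord3 j) => ->; rewrite mxE /=; lia.
Qed.

Lemma qform_mx_norm2 (R : realType) (q : qform) (A : 'M[int]_3) :
    (forall x, qform_eval q x = J (A *m x)) ->
  \sum_i \sum_j (qform_mx q i j)%:~R ^+ 2 = gram_norm2
    (map_mx intr (row 0 A)) (map_mx intr (row 1 A)) (map_mx intr (row 2 A)) :> R.
Proof.
move=> /qform_mxE hq.
under eq_bigr do under eq_bigr do rewrite hq.
rewrite /gram_norm2 /dotv !sum_ord3 !mxE !rmorphD !rmorphN !rmorphM /=; ring.
Qed.

Lemma dotv_intr (R : realType) n (u v : 'rV[int]_n) :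
  dotv (map_mx intr u) (map_mx intr v) = (dotv u v)%:~R :> R.
Proof. by rewrite rmorph_sum; apply: eq_bigr => j _; rewrite !mxE rmorphM. Qed.

Lemma vec_normE (R : realType) n (v : 'rV[int]_n) :
  vec_norm R v = Num.sqrt (dotv (map_mx intr v) (map_mx intr v)).
Proof. by congr Num.sqrt; apply: eq_bigr => j _; rewrite mxE expr2. Qed.

Theorem theorem4 (R : realType) (A : 'M[int]_3) (q : qform)
    (hq : forall x : 'cV[int]_3, qform_eval q x = J (A *m x)) :
  exists U : 'M[int]_3, AutJ U /\
    (let a := row 0 (U *m A) in
     let b := row 1 (U *m A) in
     let c := row 2 (U *m A) in
     vec_norm R a * vec_norm R c <= 9 * qform_norm R q /\
     vec_norm R b ^+ 2 <= 10 * qform_norm R q).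
Proof.
have [U [hU hab hac]] := AutJ_reduction A; exists U; split=> //=.
(* Since [U] preserves [J], the matrix [U *m A] represents the same form, so the norm on the right
   is unchanged. *)
have hUq x : qform_eval q x = J (U *m A *m x) by rewrite -mulmxA hU hq.
rewrite /qform_norm /frobenius_norm (qform_mx_norm2 R hUq) !vec_normE.
move: hab hac; set a := row 0 _; set b := row 1 _; set c := row 2 _ => hab hac.
have [||acN bN] := @reduced_bounds R _ (map_mx intr a) (map_mx intr b) (map_mx intr c).
- by rewrite !dotv_intr -intr_norm -[2]/(2%:~R) -intrM ler_int.
- by rewrite !dotv_intr ler_int.
rewrite -sqrtrM ?dotv_ge0 // sqr_sqrtr ?dotv_ge0 //.
have sqrtM (k : R) x : 0 <= k -> k * Num.sqrt x = Num.sqrt (k ^+ 2 * x).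
  by move=> k_ge0; rewrite sqrtrM ?sqr_ge0 // sqrtr_sqr ger0_norm.
rewrite !sqrtM //; split; first by apply: ler_wsqrtr; apply: le_trans acN _; lra.
rewrite -[leLHS]ger0_norm ?dotv_ge0 // -sqrtr_sqr.
by apply: ler_wsqrtr; apply: le_trans bN _; lra.
Qed.
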